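(* Let $(\mathfrak{X},+,\mathcal{A})$ be a measurable Abelian group, $k\in\mathbb{N}$, let $G$ be a probability distribution and $U$ a finite signed measure on $(\mathfrak{X},\mathcal{A})$. Assume that $|U|$ is absolutely continuous with respect to $G$ and that $U(\mathfrak{X})=0$. Let $f^{\pm}$ denote any Radon–Nikodym densities of $U^{\pm}$ with respect to $G$ and put $f=f^+-f^-$. Let $N$ be a random variable in $\mathbb{Z}_+=\{0,1,2,\dots\}$ and let $\varphi(z)=\mathrm{E}[z^N]$ ($z\in\mathbb{C}$, $|z|\leq1$) be its generating function. Set $\varphi(G)=\mathrm{E}[G^N]$, a probability distribution on $(\mathfrak{X},\mathcal{A})$, where the expectation is defined setwise. Then \[\|U^k\varphi(G)\|\leq\Big(k\int_0^1x^{k-1}\varphi(1-x)\,dx\Big)^{1/2}\Big(\int f^2\,dG\Big)^{k/2}.\] If $N$ has the Poisson distribution with parameter $t\in(0,\infty)$, then \[\|U^k\varphi(G)\|\leq\frac{1}{t^{k/2}}\sqrt{k!\,\mathrm{P}(N\geq k)}\,\Big(\int f^2\,dG\Big)^{k/2}.\]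
   Context: A measurable Abelian group $(\mathfrak{X},+,\mathcal{A})$ is a commutative group $(\mathfrak{X},+)$ together with a $\sigma$-algebra $\mathcal{A}$ on $\mathfrak{X}$ such that $(x,y)\mapsto x-y$ is measurable from $(\mathfrak{X}\times\mathfrak{X},\mathcal{A}\otimes\mathcal{A})$ to $(\mathfrak{X},\mathcal{A})$. Products and powers of finite signed measures are convolutions: $VW(A)=\int_{\mathfrak{X}}V(A-x)\,dW(x)$, with zeroth power equal to the Dirac measure $I$ at the identity $0$. $U=U^+-U^-$ is the Hahn–Jordan decomposition, $|U|=U^++U^-$, $\|U\|=|U|(\mathfrak{X})$ the total variation norm. Setwise expectation means $\mathrm{E}[G^N](A)=\mathrm{E}[G^N(A)]=\sum_{m=0}^\infty\mathrm{P}(N=m)\,G^m(A)$ for $A\in\mathcal{A}$. The integral $\int f^2\,dG$ may be $+\infty$, in which case the bounds are trivial. *)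

(* Defs.v *)
From HB Require Import structures.
From mathcomp Require Import all_boot all_order all_algebra.
From mathcomp Require Import all_classical.
From mathcomp Require Import measurable_structure measurable_function.

Set Implicit Arguments.
Unset Strict Implicit.
Unset Printing Implicit Defensive.
Local Open Scope classical_set_scope.

(* Declared before [all_analysis] is imported: HB rejects a new join of
   pointed types and Z-modules below already imported structures such as
   [PseudoMetricNormedZmod]. *)
HB.mixin Record isMeasurableZmod d T & Measurable d T & GRing.Zmodule T := {
  measurable_subr :
    measurable_fun [set: T * T] (fun xy : T * T => (xy.1 - xy.2)%R)
}.

#[short(type="measurableZmodType")]
HB.structure Definition MeasurableZmod d :=
  {T of Measurable d T & GRing.Zmodule T & isMeasurableZmod d T}.

From mathcomp Require Import all_reals all_analysis measurable_realfun.
Import Order.TTheory GRing.Theory Num.Theory.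
Import numFieldNormedType.Exports.
Local Open Scope ring_scope.
Local Open Scope ereal_scope.

Section jordan.
Context d (T : measurableType d) (R : realType).
Implicit Type nu : {charge set T -> \bar R}.

(* The choice of a Hahn decomposition is immaterial: [Hahn_decomposition_uniq]. *)
Definition hahn_pos nu : set T := projT1 (cid (Hahn_decomposition nu)).

Definition hahn_neg nu : set T :=
  projT1 (cid (projT2 (cid (Hahn_decomposition nu)))).

Lemma hahnP nu : hahn_decomposition nu (hahn_pos nu) (hahn_neg nu).
Proof. exact: projT2 (cid (projT2 (cid (Hahn_decomposition nu)))). Qed.

Definition positive_part nu : {finite_measure set T -> \bar R} :=
  jordan_pos (hahnP nu).

Definition negative_part nu : {finite_measure set T -> \bar R} :=
  jordan_neg (hahnP nu).

Definition variation_measure nu : {measure set T -> \bar R} :=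
  charge_variation (hahnP nu).

Definition tv_norm nu : \bar R := variation_measure nu [set: T].

Lemma positive_negative_partE nu A : measurable A ->
  nu A = positive_part nu A - negative_part nu A.
Proof.
move=> mA; rewrite (jordan_decomp (hahnP nu) mA) /cadd/=.
by rewrite cscaleN1.
Qed.

Lemma variationE nu A : variation_measure nu A = positive_part nu A + negative_part nu A.
Proof. by []. Qed.

Lemma negative_part_eq0 nu : (forall A, measurable A -> 0 <= nu A) ->
  forall A, negative_part nu A = 0.
Proof.
move=> nu0 A.
rewrite -[LHS]/(jordan_neg (hahnP nu) A) jordan_negE cjordan_negE /crestr0.
have [_ [mN neg] _ _] := hahnP nu.
case: ifPn => [/[!inE] mA|_]; last by rewrite oppe0.
have mAN : measurable (A `&` hahn_neg nu) by exact: measurableI.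
rewrite /crestr; suff -> : nu (A `&` hahn_neg nu) = 0 by rewrite oppe0.
by apply/eqP; rewrite eq_le nu0// andbT neg//; exact: subIsetr.
Qed.

End jordan.

Section translate.
Context d (T : measurableZmodType d).

Definition translate (A : set T) (x : T) : set T := [set (a - x)%R | a in A].

Lemma translateE A x : translate A x = (fun y => y + x)%R @^-1` A.
Proof.
apply/seteqP; split => [_ [a Aa <-]|y Ay] /=; first by rewrite subrK.
by exists (y + x)%R => //; rewrite addrK.
Qed.

Lemma measurable_addr :
  measurable_fun [set: T * T] (fun xy : T * T => (xy.1 + xy.2)%R).
Proof.
pose neg (x : T) := (0 - x)%R.
have mN : measurable_fun [set: T] neg.
  rewrite (_ : neg = (fun xy : T * T => xy.1 - xy.2)%R \o
      (fun x : T => (0%R, x)))//.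
  apply: measurableT_comp; first exact: measurable_subr.
  exact: measurable_fun_pair.
rewrite (_ : (fun _ => _) = (fun xy : T * T => xy.1 - xy.2)%R \o
    (fun xy : T * T => (xy.1, (neg \o snd) xy))); last first.
  by apply/funext => -[x y]/=; rewrite /neg sub0r opprK.
apply: measurableT_comp; first exact: measurable_subr.
apply: measurable_fun_pair; first exact: measurable_fst.
exact: measurableT_comp.
Qed.

Lemma translate_xsection A x :
  translate A x = xsection ((fun xy : T * T => xy.1 + xy.2)%R @^-1` A) x.
Proof.
rewrite translateE; apply/seteqP; split => y /=.
  by move=> Ayx; apply/xsectionP => /=; rewrite addrC.
by move=> /xsectionP/=; rewrite addrC.
Qed.

Lemma measurable_translate_prod A : measurable A ->
  measurable ((fun xy : T * T => xy.1 + xy.2)%R @^-1` A).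
Proof. by move=> mA; rewrite -[X in measurable X]setTI; exact: measurable_addr. Qed.

Lemma measurable_translate A x : measurable A -> measurable (translate A x).
Proof.
move=> mA; rewrite translate_xsection; apply: measurable_xsection.
exact: measurable_translate_prod.
Qed.

Lemma translate0 x : translate set0 x = set0.
Proof. by rewrite translateE preimage_set0. Qed.

Lemma translateT x : translate setT x = setT.
Proof. by rewrite translateE preimage_setT. Qed.

End translate.

Section convolution.
Context d (T : measurableZmodType d) (R : realType).
Implicit Types (V W : {charge set T -> \bar R}) (A : set T).

(* Integral against the signed measure [W]. *)
Definition integral_charge W (f : T -> \bar R) : \bar R :=
  \int[positive_part W]_x f x - \int[negative_part W]_x f x.

Definition convolution V W A : \bar R :=
  integral_charge W (fun x => V (translate A x)).

Lemma measurable_charge_translate V A : measurable A ->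
  measurable_fun [set: T] (fun x => V (translate A x)).
Proof.
move=> mA.
rewrite (_ : (fun _ => _) = (fun x =>
    positive_part V (translate A x) - negative_part V (translate A x))).
  apply: emeasurable_funB.
  - under eq_fun do rewrite translate_xsection.
    apply: (measurable_fun_xsection (positive_part V)).
    exact: measurable_translate_prod.
  - under eq_fun do rewrite translate_xsection.
    apply: (measurable_fun_xsection (negative_part V)).
    exact: measurable_translate_prod.
apply/funext => x.
by rewrite positive_negative_partE//; exact: measurable_translate.
Qed.

Lemma abse_le_tv_norm V A : measurable A -> `|V A| <= tv_norm V.
Proof.
move=> mA; apply: (le_trans (abse_charge_variation (hahnP V) mA)).
by apply: (@le_measure _ _ _ (variation_measure V)); rewrite ?inE.
Qed.

Lemma tv_norm_fin_num V : tv_norm V \is a fin_num.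
Proof. by rewrite /tv_norm variationE fin_numD !fin_num_measure. Qed.

Lemma integrable_charge_translate V A (mu : {finite_measure set T -> \bar R}) :
  measurable A -> mu.-integrable [set: T] (fun x => V (translate A x)).
Proof.
move=> mA; apply: (@le_integrable _ _ _ _ _ _ _ (cst (tv_norm V))) => //.
- exact: measurable_charge_translate.
- move=> x _ /=; rewrite [leRHS]gee0_abs; last exact: measure_ge0.
  by apply: abse_le_tv_norm; exact: measurable_translate.
- rewrite -(fineK (tv_norm_fin_num V)).
  exact: finite_measure_integrable_cst.
Qed.

Lemma cvg_integral_charge_translate V (mu : {finite_measure set T -> \bar R})
    (F : (set T)^nat) :
  (forall i, measurable (F i)) -> trivIset setT F ->
  \sum_(0 <= i < n) \int[mu]_x V (translate (F i) x) @[n --> \oo] -->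
  \int[mu]_x V (translate (\bigcup_i F i) x).
Proof.
move=> mF tF.
have mtF x i : measurable (translate (F i) x) by exact: measurable_translate.
have ttF x : trivIset setT (fun i => translate (F i) x).
  apply/trivIsetP => i j _ _ ij; rewrite !translateE -preimage_setI.
  by move/trivIsetP : tF => /(_ i j Logic.I Logic.I ij) ->; rewrite preimage_set0.
have bigE x : translate (\bigcup_i F i) x = \bigcup_i translate (F i) x.
  by rewrite translateE preimage_bigcup; under eq_bigcupr do rewrite -translateE.
have sumE n x : \sum_(0 <= i < n) V (translate (F i) x) =
    V (\big[setU/set0]_(i < n) translate (F i) x).
  rewrite big_mkord.
  rewrite (@charge_semi_additive _ _ _ V (fun i => translate (F i) x))//.
  exact: bigsetU_measurable.
rewrite (_ : (fun n => _) = (fun n =>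
    \int[mu]_x (\sum_(0 <= i < n) V (translate (F i) x)))); last first.
  apply/funext => n; rewrite integral_sum// => i.
  exact: integrable_charge_translate.
apply: (@dominated_cvg _ _ _ mu _ measurableT _ _ (cst (tv_norm V))).
- by move=> n; apply: emeasurable_sum => i; exact: measurable_charge_translate.
- move=> x _; rewrite bigE; apply: charge_semi_sigma_additive => //.
  exact: bigcup_measurable.
- by move=> x _; exact: tv_norm_fin_num.
- rewrite -(fineK (tv_norm_fin_num V)).
  exact: finite_measure_integrable_cst.
- move=> n x _ /=; rewrite sumE; apply: abse_le_tv_norm.
  exact: bigsetU_measurable.
Qed.

Section convolution_charge.
Variables V W : {charge set T -> \bar R}.

Let convolution0 : convolution V W set0 = 0.
Proof.
rewrite /convolution /integral_charge.
under eq_integral do rewrite translate0 charge0.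
under [X in _ - X]eq_integral do rewrite translate0 charge0.
by rewrite !integral0 sube0.
Qed.

Let convolution_fin_num A : measurable A -> convolution V W A \is a fin_num.
Proof.
move=> mA; rewrite /convolution /integral_charge fin_numB.
by rewrite !integrable_fin_num//; exact: integrable_charge_translate.
Qed.

Let convolution_sigma_additive : semi_sigma_additive (convolution V W).
Proof.
move=> F mF tF mUF; rewrite /convolution /integral_charge.
have fin (mu : {finite_measure set T -> \bar R}) A : measurable A ->
    \int[mu]_x V (translate A x) \is a fin_num.
  by move=> mA; rewrite integrable_fin_num//; exact: integrable_charge_translate.
rewrite (_ : (fun n => _) = (fun n =>
    \sum_(0 <= i < n) \int[positive_part W]_x V (translate (F i) x) -
    \sum_(0 <= i < n) \int[negative_part W]_x V (translate (F i) x))).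
  apply: cvgeB; last 2 first.
  - exact: cvg_integral_charge_translate.
  - exact: cvg_integral_charge_translate.
  - by apply: fin_num_adde_defl; rewrite fin_numN fin.
apply/funext => n.
have sumB (a b : nat -> \bar R) : (forall i, b i \is a fin_num) ->
    \sum_(0 <= i < n) (a i - b i) =
    \sum_(0 <= i < n) a i - \sum_(0 <= i < n) b i.
  move=> bfin; elim: n => [|n ih]; first by rewrite !big_nil sube0.
  by rewrite !big_nat_recr//= ih [in RHS]fin_num_oppeD// addeACA.
by apply: sumB => i; exact: fin.
Qed.

HB.instance Definition _ := isCharge.Build d T R (convolution V W)
  convolution0 convolution_fin_num convolution_sigma_additive.

End convolution_charge.

Fixpoint convolution_pow V (n : nat) : {charge set T -> \bar R} :=
  if n is n'.+1 then convolution (convolution_pow V n') V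
  else charge_of_finite_measure (dirac (0 : T)%R).

End convolution.

Section generating_function.
Context d (Omega : measurableType d) (R : realType) (P : probability Omega R).

(* Restricted to real arguments [z]. *)
Definition generating_function (N : {RV P >-> nat}) (z : R) : \bar R :=
  'E_P[fun w => (z ^+ N w)%R].

End generating_function.

Section compound.
Context d (T : measurableZmodType d) (R : realType).
Context d' (Omega : measurableType d') (P : probability Omega R).
Variables (G : probability T R) (N : {RV P >-> nat}).

Definition prob_pow (n : nat) : {charge set T -> \bar R} :=
  convolution_pow (charge_of_finite_measure G) n.

Lemma convolution_ge0 (V W : {charge set T -> \bar R}) :
  (forall A, 0 <= V A) -> (forall A, 0 <= W A) ->
  forall A, 0 <= convolution V W A.
Proof.
move=> V0 W0 A; rewrite /convolution /integral_charge.
rewrite [X in _ - X](_ : _ = 0); last first.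
  rewrite (eq_measure_integral mzero) ?integral_measure_zero// => B mB _.
  exact: negative_part_eq0.
by rewrite sube0; apply: integral_ge0 => x _; exact: V0.
Qed.

Lemma convolutionT (V W : {charge set T -> \bar R}) :
  convolution V W setT = V setT * W setT.
Proof.
rewrite /convolution /integral_charge.
under eq_integral do rewrite translateT.
under [X in _ - X]eq_integral do rewrite translateT.
have Vfin : V setT \is a fin_num by exact: fin_num_measure.
rewrite -(fineK Vfin) !integral_cst// -muleBr//; last first.
  by apply: fin_num_adde_defl; rewrite fin_numN fin_num_measure.
by rewrite -(positive_negative_partE W measurableT).
Qed.

Lemma prob_pow_ge0 n A : 0 <= prob_pow n A.
Proof.
rewrite /prob_pow; elim: n A => [|n ih] A /=; first exact: measure_ge0.
by apply: convolution_ge0 => // B; exact: measure_ge0.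
Qed.

Lemma prob_powT n : prob_pow n setT = 1.
Proof.
rewrite /prob_pow; elim: n => [|n ih] /=.
  by rewrite /charge_of_finite_measure diracT.
by rewrite convolutionT ih mul1e; exact: probability_setT.
Qed.

(* The setwise expectation of the random measure [G^N]; [compoundE] gives its
   expression as a series, and the instances below make it a probability. *)
Definition compound (A : set T) : \bar R := \int[P]_w prob_pow (N w) A.

Let measurable_prob_pow A :
  measurable_fun [set: Omega] (fun w => prob_pow (N w) A).
Proof.
by apply: (@measurableT_comp _ _ _ _ _ _ (fun n => prob_pow n A)).
Qed.

Let compound0 : compound set0 = 0.
Proof.
by rewrite /compound; under eq_integral do rewrite charge0; rewrite integral0.
Qed.

Let compound_ge0 A : 0 <= compound A.
Proof. by apply: integral_ge0 => w _; exact: prob_pow_ge0. Qed.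

Let compound_sigma_additive : semi_sigma_additive compound.
Proof.
move=> F mF tF mUF.
rewrite /compound (_ : (\int[P]_w _) =
    \sum_(n <oo) \int[P]_w prob_pow (N w) (F n)).
  apply: is_cvg_nneseries => n _ _.
  by apply: integral_ge0 => w _; exact: prob_pow_ge0.
rewrite -integral_nneseries//; last by move=> n w _; exact: prob_pow_ge0.
apply: eq_integral => w _; apply/esym/cvg_lim => //.
exact: charge_semi_sigma_additive.
Qed.

HB.instance Definition _ := isMeasure.Build d T R compound
  compound0 compound_ge0 compound_sigma_additive.

Let compoundT : compound setT = 1.
Proof.
rewrite /compound; under eq_integral do rewrite prob_powT.
by rewrite integral_cst// mul1e; exact: probability_setT.
Qed.

HB.instance Definition _ := Measure_isProbability.Build d T R compound compoundT.

Lemma compoundE A : compound A =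
  \sum_(m <oo) P [set w | N w = m] * prob_pow m A.
Proof.
rewrite /compound -(@ge0_integral_distribution _ _ _ _ _ _ N
  (fun n => prob_pow n A))//; last by move=> n; exact: prob_pow_ge0.
have -> : [set: nat] = \bigcup_n [set n].
  by apply/seteqP; split => // n _; exists n.
rewrite ge0_integral_bigcup//; last 2 first.
- by move=> n _; exact: prob_pow_ge0.
- by apply/trivIsetP => i j _ _ /eqP ij; apply/seteqP; split => // n [/= -> /ij].
apply: eq_eseriesr => n _.
rewrite (eq_integral (cst (prob_pow n A))); last by move=> m /[!inE] ->.
by rewrite integral_cst// muleC.
Qed.


End compound.

(* Nonnegativity of [f] is not imposed: it holds [mu]-almost everywhere. *)
Definition is_density d (T : measurableType d) (R : realType)
    (mu nu : {measure set T -> \bar R}) (f : T -> \bar R) :=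
  measurable_fun [set: T] f /\
  forall A, measurable A -> nu A = \int[mu]_(x in A) f x.

(* Main.v *)
Require Import Defs.
From mathcomp Require Import all_boot all_order all_algebra.
From mathcomp Require Import all_classical all_reals all_analysis measurable_realfun.
From mathcomp Require Import ring lra.
Set Implicit Arguments.
Unset Strict Implicit.
Unset Printing Implicit Defensive.
Import Order.TTheory GRing.Theory Num.Theory.
Import numFieldNormedType.Exports.
Local Open Scope classical_set_scope.
Local Open Scope ring_scope.
Local Open Scope ereal_scope.

(** The coefficient [1 / 'C(m + k, k)] comes from averaging over the order of
    the convolution factors. Let [X_1, ..., X_n] be independent with law [G],
    [n = m + k]. Since [f] is a density of [U], [U^k G^m (A)] is the mean of
    [f(X_1) ... f(X_k) 1_A(X_1 + ... + X_n)]; the sum and the law are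
    invariant under permutations, so [f(X_1) ... f(X_k)] may be replaced by
    the average of the products of [f] over all [k]-subsets of the sample,
    namely [e_k / 'C(n, k)] with [e_k] the elementary symmetric polynomial in
    the [f(X_i)]. As [U] has total mass [0], each [f(X_i)] is centred, hence
    the ['C(n, k)] monomials of [e_k] are pairwise orthogonal in [L^2], each
    of squared norm [v^k] with [v = \int f^2 dG]. Cauchy-Schwarz gives
    [|U^k G^m| <= sqrt (v^k / 'C(m + k, k))] ([mixed_pow_difference_le]).

    The sample is built one observation at a time, and the identity
    [e_j (x_1 .. x_n+1) = e_j (x_1 .. x_n) + f(x_n+1) * e_(j-1) (x_1 .. x_n)]
    drives an induction on [n] in which both the second moment of [e_j] and
    the signed law ['C(n, j) U^j G^(n - j)] follow Pascal's rule
    ([symmetric_representation]). On the side of measures this requires that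
    convolution be commutative and associative, which is Fubini's theorem for
    signed measures ([integral_charge_swap], [convolutionAC]).

    The compound distribution is the mixture of the [G^m] over the law of
    [N] ([convolution_compound]), so a second use of Cauchy-Schwarz bounds
    [|U^k phi(G)|] by [sqrt (v^k E[1 / 'C(N + k, k)])]. The mean is
    [k \int_0^1 x^(k-1) phi(1 - x) dx], because [1 / 'C(n + k, k)] is the Beta
    integral of [k x^(k-1) (1 - x)^n], and equals [k! t^-k P(N >= k)] when [N]
    is Poisson. If [v] is infinite, the right-hand side is infinite since
    that mean is positive. *)

(** * Product integrals *)

Lemma bounded_integrable d (T : measurableType d) (R : realType)
    (mu : {finite_measure set T -> \bar R}) (h : T -> \bar R) (M : R) :
  measurable_fun [set: T] h -> (forall x, `|h x| <= M%:E) ->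
  mu.-integrable [set: T] h.
Proof.
move=> mh hM; apply: (@le_integrable _ _ _ _ _ _ _ (cst M%:E)) => //.
  by move=> x _ /=; rewrite (le_trans (hM x))// lee_fin ler_norm.
exact: finite_measure_integrable_cst.
Qed.

Section integration.
Context d1 d2 (T1 : measurableType d1) (T2 : measurableType d2) (R : realType).

Lemma bounded_fubini (mu : {finite_measure set T1 -> \bar R})
    (nu : {finite_measure set T2 -> \bar R}) (h : T1 * T2 -> \bar R) (M : R) :
  measurable_fun [set: T1 * T2] h -> (forall z, `|h z| <= M%:E) ->
  [/\ mu.-integrable [set: T1] (fun x => \int[nu]_y h (x, y)),
      nu.-integrable [set: T2] (fun y => \int[mu]_x h (x, y)) &
      \int[mu]_x \int[nu]_y h (x, y) = \int[nu]_y \int[mu]_x h (x, y)].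
Proof.
move=> mh hM.
have hi : (mu \x nu).-integrable [set: T1 * T2] h.
  apply/integrable12ltyP => //.
  have M0 : 0 <= M%:E by rewrite (le_trans _ (hM (point, point))).
  apply: (@le_lt_trans _ _ (\int[mu]_x (cst (M%:E * nu setT)) x)).
    apply: ge0_le_integral => //.
    - by move=> x _; exact: integral_ge0.
    - apply: (measurable_fun_fubini_tonelli_F (abse \o h)) => //=.
      exact: measurableT_comp.
    - move=> x _; rewrite -integral_cst//; apply: ge0_le_integral => //.
      by apply: measurableT_comp => //; exact: measurableT_comp.
  rewrite integral_cst// -ge0_fin_numE ?fin_numM ?fin_num_measure//.
  by rewrite !mule_ge0.
split; [exact: (integrable_fubini_F hi)| |exact: Fubini hi].
apply: (@bounded_integrable _ _ _ _ _ (M * fine (mu setT))%R).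
  exact: (measurable_fubini_G hi).
move=> y; rewrite EFinM fineK ?fin_num_measure// -integral_cst//.
apply: le_trans (le_abse_integral _ _ _) _ => //; first exact: measurableT_comp.
by apply: ge0_le_integral => //; do 2?apply: measurableT_comp.
Qed.

Lemma integrable_prodM (mu : {sigma_finite_measure set T1 -> \bar R})
    (nu : {sigma_finite_measure set T2 -> \bar R}) (a : T1 -> R) (b : T2 -> R) :
  mu.-integrable [set: T1] (EFin \o a) ->
  nu.-integrable [set: T2] (EFin \o b) ->
  (mu \x nu).-integrable [set: T1 * T2] (fun z => (a z.1 * b z.2)%:E).
Proof.
move=> ia ib.
have ma : measurable_fun [set: T1] a by exact/measurable_EFinP/(measurable_int _ ia).
have mb : measurable_fun [set: T2] b by exact/measurable_EFinP/(measurable_int _ ib).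
apply/integrable12ltyP.
  by apply/measurable_EFinP/measurable_funM; exact: measurableT_comp.
have -> : \int[mu]_x \int[nu]_y `|(a x * b y)%:E| =
    \int[mu]_x (`|(a x)%:E| * \int[nu]_y `|(b y)%:E|).
  apply: eq_integral => x _; rewrite -ge0_integralZl//; last first.
    exact/measurableT_comp/measurable_EFinP.
  by apply: eq_integral => y _; rewrite EFinM abseM.
have [_ ial] := integrableP _ _ _ ia; have [_ ibl] := integrableP _ _ _ ib.
rewrite ge0_integralZr//; last 2 first.
- exact/measurableT_comp/measurable_EFinP.
- exact: integral_ge0.
by rewrite lte_mul_pinfty// ?integral_ge0// ge0_fin_numE// integral_ge0.
Qed.

(** The weight [c] couples the two variables (below, as the indicator that a
    sum lies in a set); boundedness by [1] keeps the integrand dominated by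
    [a * b]. *)
Lemma integral_prodM (mu : {sigma_finite_measure set T1 -> \bar R})
    (nu : {sigma_finite_measure set T2 -> \bar R}) (a : T1 -> R) (b : T2 -> R)
    (c : T1 * T2 -> R) :
  mu.-integrable [set: T1] (EFin \o a) ->
  nu.-integrable [set: T2] (EFin \o b) ->
  measurable_fun [set: T1 * T2] c -> (forall z, `|c z| <= 1)%R ->
  (mu \x nu).-integrable [set: T1 * T2] (fun z => (a z.1 * b z.2 * c z)%:E) /\
  \int[mu \x nu]_z (a z.1 * b z.2 * c z)%:E =
    \int[nu]_y ((b y)%:E * \int[mu]_x (a x * c (x, y))%:E).
Proof.
move=> ia ib mc c1.
have ma : measurable_fun [set: T1] a by exact/measurable_EFinP/(measurable_int _ ia).
have mb : measurable_fun [set: T2] b by exact/measurable_EFinP/(measurable_int _ ib).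
have ii : (mu \x nu).-integrable [set: T1 * T2]
    (fun z => (a z.1 * b z.2 * c z)%:E).
  apply: le_integrable (integrable_prodM ia ib) => //.
    apply/measurable_EFinP/measurable_funM => //.
    by apply: measurable_funM; exact: measurableT_comp.
  by move=> z _ /=; rewrite lee_fin normrM ler_piMr.
split => //; rewrite -integral21_prod_meas1//; apply: eq_integral => y _.
rewrite -integralZl//.
  by apply: eq_integral => x _ /=; rewrite -EFinM (mulrC (a x)) mulrA.
apply: le_integrable ia => //.
  by apply/measurable_EFinP/measurable_funM => //; exact: measurableT_comp.
by move=> x _ /=; rewrite lee_fin normrM ler_piMr.
Qed.

End integration.

(** * Integration against signed measures *)

Section signed_integration.
Context d (T : measurableZmodType d) (R : realType).
Implicit Types V W : {charge set T -> \bar R}.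

Lemma integral_charge_finite_measure (mu : {finite_measure set T -> \bar R})
    (g : T -> \bar R) :
  integral_charge (charge_of_finite_measure mu) g = \int[mu]_x g x.
Proof.
pose W : {charge set T -> \bar R} := charge_of_finite_measure mu.
have n0 : forall A, negative_part W A = 0.
  by apply: negative_part_eq0 => A _; exact: measure_ge0.
rewrite -/(integral_charge W g) /integral_charge [X in _ - X](_ : _ = 0); last first.
  rewrite (eq_measure_integral mzero) ?integral_measure_zero// => B mB _.
  exact: n0.
rewrite sube0; apply: eq_measure_integral => A mA _.
by have := positive_negative_partE W mA; rewrite [X in _ - X](n0 A) sube0.
Qed.

Lemma integral_charge_indic W A : measurable A ->
  integral_charge W (fun x => (\1_A x)%:E) = W A.
Proof.
move=> mA; rewrite /integral_charge !integral_indic// !setIT.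
exact/esym/positive_negative_partE.
Qed.

Lemma eq_integral_charge W (f g : T -> \bar R) : f =1 g ->
  integral_charge W f = integral_charge W g.
Proof. by move=> /funext ->. Qed.

Context d' (T' : measurableType d').

Lemma integral_charge_fubini W (mu : {finite_measure set T' -> \bar R})
    (h : T * T' -> \bar R) (M : R) :
  measurable_fun [set: T * T'] h -> (forall z, `|h z| <= M%:E) ->
  mu.-integrable [set: T'] (fun y => integral_charge W (fun x => h (x, y))) /\
  integral_charge W (fun x => \int[mu]_y h (x, y)) =
    \int[mu]_y integral_charge W (fun x => h (x, y)).
Proof.
move=> mh hM.
have [ip jp ep] := bounded_fubini (positive_part W) mu mh hM.
have [iN jN eN] := bounded_fubini (negative_part W) mu mh hM.
split; first exact: integrableB.
by rewrite /integral_charge ep eN -integralB.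
Qed.

End signed_integration.

Section signed_fubini.
Context d (T : measurableZmodType d) d' (T' : measurableZmodType d') (R : realType).

Lemma integral_charge_swap (V : {charge set T -> \bar R})
    (W : {charge set T' -> \bar R}) (h : T * T' -> \bar R) (M : R) :
  measurable_fun [set: T * T'] h -> (forall z, `|h z| <= M%:E) ->
  integral_charge V (fun x => integral_charge W (fun y => h (x, y))) =
  integral_charge W (fun y => integral_charge V (fun x => h (x, y))).
Proof.
move=> mh hM.
have [ip ep] := integral_charge_fubini V (positive_part W) mh hM.
have [iN eN] := integral_charge_fubini V (negative_part W) mh hM.
rewrite [RHS]/integral_charge -/(integral_charge V) -ep -eN.
have [ipp _ _] := bounded_fubini (positive_part V) (positive_part W) mh hM.
have [ipn _ _] := bounded_fubini (positive_part V) (negative_part W) mh hM.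
have [inp _ _] := bounded_fubini (negative_part V) (positive_part W) mh hM.
have [inn _ _] := bounded_fubini (negative_part V) (negative_part W) mh hM.
rewrite /integral_charge (integralB _ ipp ipn)// (integralB _ inp inn)//.
have := integrable_fin_num measurableT ipp.
have := integrable_fin_num measurableT ipn.
have := integrable_fin_num measurableT inp.
have := integrable_fin_num measurableT inn.
move=> /fineK <- /fineK <- /fineK <- /fineK <-.
by rewrite -!EFinB !opprD !opprK addrACA.
Qed.

End signed_fubini.

(** * Convolution is commutative and associative *)

Section convolution_algebra.
Context d (T : measurableZmodType d) (R : realType).
Implicit Types V W Z : {charge set T -> \bar R}.

Lemma translate_translate (A : set T) x y :
  translate (translate A x) y = translate A (x + y)%R.
Proof.
rewrite !translateE; apply/seteqP.
by split => z /=; rewrite -addrA (addrC y).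
Qed.

Lemma indic_translate (A : set T) x y :
  \1_(translate A x) y = \1_A (y + x)%R :> R.
Proof. by rewrite translateE. Qed.

Lemma convolutionE V W A : measurable A ->
  convolution V W A =
  integral_charge W (fun x => integral_charge V (fun y => (\1_A (y + x)%R)%:E)).
Proof.
move=> mA; apply: eq_integral_charge => x.
rewrite -integral_charge_indic; last exact: measurable_translate.
by apply: eq_integral_charge => y; rewrite indic_translate.
Qed.

Lemma convolutionC V W A : measurable A ->
  convolution V W A = convolution W V A.
Proof.
move=> mA; rewrite !convolutionE//.
rewrite (@integral_charge_swap _ _ _ _ _ W V
  (fun z => (\1_A (z.2 + z.1)%R)%:E) 1%R).
- apply: eq_integral_charge => x; apply: eq_integral_charge => y /=.
  by rewrite addrC.
- apply/measurable_EFinP; apply: measurableT_comp => //.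
  rewrite (_ : (fun _ => _) = (fun xy : T * T => xy.1 + xy.2)%R); last first.
    by apply/funext => z; rewrite addrC.
  exact: measurable_addr.
- by move=> z; rewrite lee_fin indicE ger0_norm ?lern1 ?leq_b1.
Qed.

Lemma eq_convolutionl V V' W A : measurable A ->
  (forall B, measurable B -> V B = V' B) ->
  convolution V W A = convolution V' W A.
Proof.
move=> mA VV'; apply: eq_integral_charge => x; apply: VV'.
exact: measurable_translate.
Qed.

(** Both sides integrate [V (A - x - y)] against [W] in one variable and [Z]
    in the other, so the identity is Fubini's theorem for a bounded function;
    associativity then follows from commutativity without any rule for
    integrating against a convolution. *)
Lemma convolutionAC V W Z A : measurable A ->
  convolution (convolution V W) Z A = convolution (convolution V Z) W A.
Proof.
move=> mA.
have convE W1 W2 : convolution (convolution V W1) W2 A = integral_charge W2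
    (fun x => integral_charge W1 (fun y => V (translate A (x + y)%R))).
  apply: eq_integral_charge => x; apply: eq_integral_charge => y.
  by rewrite translate_translate.
rewrite !convE (@integral_charge_swap _ _ _ _ _ Z W
  (fun z => V (translate A (z.1 + z.2)%R)) (fine (tv_norm V))).
- apply: eq_integral_charge => x; apply: eq_integral_charge => y /=.
  by rewrite addrC.
- apply: (@measurableT_comp _ _ _ _ _ _ (fun x => V (translate A x))).
    exact: measurable_charge_translate.
  exact: measurable_addr.
- move=> z; rewrite fineK ?tv_norm_fin_num//; apply: abse_le_tv_norm.
  exact: measurable_translate.
Qed.

Lemma convolutionA V W Z A : measurable A ->
  convolution (convolution V W) Z A = convolution V (convolution W Z) A.
Proof.
move=> mA; rewrite (eq_convolutionl _ (V' := convolution W V))//.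
  by rewrite convolutionAC// convolutionC.
by move=> B mB; exact: convolutionC.
Qed.

End convolution_algebra.

(** * Square-integrable functions on a probability space *)

Section square_integrable.
Context d (T : measurableType d) (R : realType) (P : probability T R).
Implicit Types a b : T -> R.

Lemma square_integrableM a b :
  measurable_fun [set: T] a -> measurable_fun [set: T] b ->
  P.-integrable [set: T] (fun x => (a x ^+ 2)%:E) ->
  P.-integrable [set: T] (fun x => (b x ^+ 2)%:E) ->
  P.-integrable [set: T] (fun x => (a x * b x)%:E).
Proof.
move=> ma mb ia ib; apply: le_integrable (integrableD _ ia ib) => //.
  exact/measurable_EFinP/measurable_funM.
move=> x _ /=; rewrite lee_fin [leRHS]ger0_norm ?addr_ge0 ?sqr_ge0//.
rewrite normrM -[leLHS]mul1r -ler_pdivlMl// invr1 mul1r.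
rewrite -(real_normK (num_real (a x))) -(real_normK (num_real (b x))).
rewrite -subr_ge0.
have -> : (`|a x| ^+ 2 + `|b x| ^+ 2 - `|a x| * `|b x| =
  ((`|a x| - `|b x|) ^+ 2 + `|a x| ^+ 2 + `|b x| ^+ 2) / 2)%R by field.
by rewrite divr_ge0// !addr_ge0// sqr_ge0.
Qed.

Lemma square_integrable_integrable a :
  measurable_fun [set: T] a ->
  P.-integrable [set: T] (fun x => (a x ^+ 2)%:E) ->
  P.-integrable [set: T] (EFin \o a).
Proof.
move=> ma ia.
have i1 : P.-integrable [set: T] (fun x => (cst 1%R x ^+ 2)%:E).
  exact: (finite_measure_integrable_cst P (1 ^+ 2)%R).
apply: eq_integrable (square_integrableM ma _ ia i1) => // x _ /=.
by rewrite mulr1.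
Qed.

(** Cauchy-Schwarz against the constant [1], by integrating
    [2 y |a| <= a ^ 2 + y ^ 2] with [y] the mean of [|a|]. *)
Lemma integral_le_sqrt_integral_sqr a (s : R) :
  measurable_fun [set: T] a ->
  P.-integrable [set: T] (fun x => (a x ^+ 2)%:E) ->
  \int[P]_x (a x ^+ 2)%:E = s%:E ->
  \int[P]_x `|(a x)%:E| <= (Num.sqrt s)%:E.
Proof.
move=> ma ia sE.
have ii := integrable_abse (square_integrable_integrable ma ia).
rewrite -(fineK (integrable_fin_num measurableT ii)).
set y := fine _.
have yE : \int[P]_x `|(a x)%:E| = y%:E.
  by rewrite fineK// integrable_fin_num.
have y0 : (0 <= y)%R by apply: fine_ge0; apply: integral_ge0 => x _ /=.
suff ys : (y ^+ 2 <= s)%R.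
  by rewrite lee_fin -(ger0_norm y0) -sqrtr_sqr; exact: ler_wsqrtr.
have : (2 * y)%:E * \int[P]_x `|(a x)%:E| <=
    \int[P]_x ((a x ^+ 2)%:E + cst ((y ^+ 2)%:E) x).
  rewrite -integralZl//; apply: le_integral => //.
  - exact: integrableZl.
  - by apply: integrableD => //; exact: finite_measure_integrable_cst.
  - move=> x _ /=; rewrite lee_fin -(real_normK (num_real (a x))).
    rewrite -subr_ge0 (_ : _ - _ = (`|a x| - y) ^+ 2)%R ?sqr_ge0//.
    by ring.
rewrite integralD//; last exact: finite_measure_integrable_cst.
rewrite [X in _ + X](integral_cst _ measurableT).
rewrite [X in _ + _ * X]probability_setT mule1 sE yE -EFinD -EFinM lee_fin.
by nra.
Qed.

End square_integrable.

Lemma integral_prod_mul d1 d2 (T1 : measurableType d1) (T2 : measurableType d2)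
    (R : realType) (P : probability T1 R) (Q : probability T2 R)
    (a : T1 -> R) (b : T2 -> R) :
  P.-integrable [set: T1] (EFin \o a) ->
  Q.-integrable [set: T2] (EFin \o b) ->
  \int[P \x Q]_z (a z.1 * b z.2)%:E =
  \int[P]_x (a x)%:E * \int[Q]_y (b y)%:E.
Proof.
move=> ia ib.
have [|z|_] := @integral_prodM _ _ _ _ _ P Q a b (cst 1%R) ia ib => //.
  by rewrite normr1.
under eq_integral do rewrite mulr1; move=> ->.
have af : \int[P]_x (a x)%:E \is a fin_num by rewrite integrable_fin_num.
rewrite -(fineK af) muleC -integralZr//; apply: eq_integral => y _ /=.
by rewrite fineK//; congr (_ * _); apply: eq_integral => x _; rewrite mulr1.
Qed.

(** * Elementary symmetric functions of a sample *)

Section symmetric_functions.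
Context d (T : measurableZmodType d) (R : realType).
Variables (G : probability T R) (U : {charge set T -> \bar R}).
Variables (f : T -> R) (v : R).
Hypothesis mf : measurable_fun [set: T] f.
Hypothesis if2 : G.-integrable [set: T] (fun x => (f x ^+ 2)%:E).
Hypothesis f2E : \int[G]_x (f x ^+ 2)%:E = v%:E.
Hypothesis f0 : \int[G]_x (f x)%:E = 0.
Hypothesis UE : forall (g : T -> \bar R) (M : R),
  measurable_fun [set: T] g -> (forall x, `|g x| <= M%:E) ->
  integral_charge U g = \int[G]_x (g x * (f x)%:E).

Definition mixed_pow j m : {charge set T -> \bar R} :=
  convolution (convolution_pow U j) (prob_pow G m).

Lemma mixed_pow_prob j m A : measurable A ->
  convolution (mixed_pow j m) (charge_of_finite_measure G) A =
  mixed_pow j m.+1 A.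
Proof. by move=> mA; rewrite convolutionA. Qed.

Lemma mixed_pow_charge j m A : measurable A ->
  convolution (mixed_pow j m) U A = mixed_pow j.+1 m A.
Proof. by move=> mA; rewrite convolutionAC. Qed.

Lemma mixed_pow00 A : measurable A -> mixed_pow 0 0 A = \d_(0 : T)%R A.
Proof.
move=> mA; rewrite /mixed_pow /prob_pow /= /convolution.
rewrite integral_charge_finite_measure.
rewrite integral_dirac//; last exact: measurable_charge_translate.
have -> : translate A (0 : T)%R = A.
  by rewrite translateE; apply/seteqP; split => x /=; rewrite addr0.
by rewrite diracT mul1e.
Qed.

Lemma mixed_pow_fin_num j m A : measurable A -> mixed_pow j m A \is a fin_num.
Proof. by move=> mA; exact: fin_num_measure. Qed.

(** [Om] plays the role of the space of samples of size [n], [S] of the sum of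
    the sample and [e j] of the [j]-th elementary symmetric polynomial in the
    values of [f]. Only the second moments and the signed laws of the sum
    matter, hence the existential quantification: the induction adds an
    observation by a binary product and never forms an [n]-fold one. *)
Lemma symmetric_representation n :
  exists d' (Om : measurableType d') (Q : probability Om R)
    (S : Om -> T) (e : nat -> Om -> R),
  [/\ measurable_fun [set: Om] S,
      forall j, measurable_fun [set: Om] (e j),
      forall j, Q.-integrable [set: Om] (fun w => (e j w ^+ 2)%:E),
      forall j, \int[Q]_w (e j w ^+ 2)%:E = ('C(n, j)%:R * v ^+ j)%:E &
      forall j A, measurable A -> \int[Q]_w (e j w * \1_A (S w))%:E =
        'C(n, j)%:R%:E * mixed_pow j (n - j) A].
Proof.
have if1 := square_integrable_integrable mf if2.
have i1 d' (Om : measurableType d') (Q : probability Om R) :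
    Q.-integrable [set: Om] (EFin \o cst 1%R).
  exact: finite_measure_integrable_cst.
elim: n => [|n [d' [Om [Q [S [e [mS me ie e2E eE]]]]]]].
  pose e (j : nat) : T -> R := cst (j == 0%N)%:R.
  exists d, T, (dirac (0 : T)%R : probability T R), id, e.
  split=> //.
  - by move=> j; exact: (finite_measure_integrable_cst _ ((j == 0%N)%:R ^+ 2)%R).
  - move=> j.
    rewrite [LHS](integral_cst _ measurableT ((j == 0%N)%:R ^+ 2)%:E).
    rewrite [X in _ * X]diracT mule1 bin0n.
    by case: j => [|j] /=; rewrite ?expr0 ?mul1r ?mul0r ?expr1n ?expr0n.
  - move=> j A mA; rewrite integral_dirac//; last first.
      by apply/measurable_EFinP/measurable_funM.
    rewrite diracT mul1e bin0n sub0n EFinM.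
    by case: j => [|j] /=; rewrite ?mul0e// !mul1e mixed_pow00.
(* [p j] is [e (j - 1)], read as [0] when [j = 0]; [be] is treated alike, so
   that Pascal's rule [binE] covers [j = 0] as well. *)
pose p j : Om -> R := if j is i.+1 then e i else cst 0%R.
pose be j := if j is i.+1 then 'C(n, i) else 0%N.
have binE j : 'C(n.+1, j) = ('C(n, j) + be j)%N.
  by case: j => [|j]; rewrite ?binS ?bin0 ?addn0.
have mp j : measurable_fun [set: Om] (p j) by case: j => [|j] //=.
have ip j : Q.-integrable [set: Om] (fun w => (p j w ^+ 2)%:E).
  by case: j => [|j] //=; exact: (finite_measure_integrable_cst Q (0 ^+ 2)%R).
have p2E j : \int[Q]_w (p j w ^+ 2)%:E * v%:E = ((be j)%:R * v ^+ j)%:E.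
  case: j => [|j] /=; last by rewrite e2E -EFinM -mulrA exprSr.
  by under eq_integral do rewrite expr0n; rewrite integral0 mul0e mul0r.
pose S' (z : Om * T) := (S z.1 + z.2)%R.
(* The factor [1] gives both summands the shape [a z.1 * b z.2] required by
   the product lemmas. *)
pose e' j (z : Om * T) := (e j z.1 * 1 + p j z.1 * f z.2)%R.
have mS' : measurable_fun [set: Om * T] S'.
  apply: (@measurableT_comp _ _ _ _ _ _ (fun xy : T * T => xy.1 + xy.2)%R
    _ (fun z : Om * T => (S z.1, z.2))); first exact: measurable_addr.
  by apply: measurable_fun_pair => //; exact: measurableT_comp.
have me' j : measurable_fun [set: Om * T] (e' j).
  apply: measurable_funD; apply: measurable_funM => //;
    by apply: measurableT_comp.
have iee j : Q.-integrable [set: Om] (EFin \o e j).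
  exact: square_integrable_integrable.
have ipp j : Q.-integrable [set: Om] (EFin \o p j).
  exact: square_integrable_integrable.
have iep j : Q.-integrable [set: Om] (EFin \o (fun w => e j w * p j w)%R).
  exact: square_integrableM.
have e'2 j : (fun z => (e' j z ^+ 2)%:E) =
   (fun z => ((e j z.1 ^+ 2) * cst 1 z.2)%:E +
     (2%:E * (e j z.1 * p j z.1 * f z.2)%:E + ((p j z.1 ^+ 2) * f z.2 ^+ 2)%:E)).
  apply/funext => z; rewrite -EFinM -!EFinD; congr EFin; rewrite /e'/=; ring.
have J1 j := integrable_prodM (ie j) (i1 _ _ G).
have J2 j := integrable_prodM (iep j) if1.
have J3 j := integrable_prodM (ip j) if2.
have J23 j := integrableD measurableT (integrableZl measurableT 2%R (J2 j)) (J3 j).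
exists _, (Om * T)%type, (Q \x G : probability _ R), S', e'; split => //.
- by move=> j; rewrite e'2; apply: (integrableD measurableT (J1 j) (J23 j)).
- move=> j; rewrite e'2 (integralD measurableT (J1 j) (J23 j)).
  rewrite (integralD measurableT (integrableZl measurableT 2%R (J2 j)) (J3 j)).
  rewrite (integralZl measurableT (J2 j)).
  rewrite (integral_prod_mul (ie j) (i1 _ _ G)).
  rewrite (integral_prod_mul (iep j) if1) (integral_prod_mul (ip j) if2).
  (* The cross term carries the factor [\int f dG = 0]: orthogonality. *)
  rewrite f0 mule0 mule0 add0e f2E p2E.
  rewrite [X in _ * X + _](integral_cst _ measurableT (1%R)%:E).
  rewrite [X in _ * (_ * X)]probability_setT !mule1 e2E.
  by rewrite -EFinD -mulrDl -natrD binE.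
- move=> j A mA.
  pose c z : R := \1_A (S' z).
  have mc : measurable_fun [set: Om * T] c by exact: measurableT_comp.
  have c1 z : (`|c z| <= 1)%R by rewrite /c indicE ger0_norm ?lern1 ?leq_b1.
  have [K1 E1] := integral_prodM (iee j) (i1 _ _ G) mc c1.
  have [K2 E2] := integral_prodM (ipp j) if1 mc c1.
  have -> : (fun z => (e' j z * \1_A (S' z))%:E) =
    (fun z => (e j z.1 * cst 1 z.2 * c z)%:E + (p j z.1 * f z.2 * c z)%:E).
    by apply/funext => z; rewrite -EFinD -mulrDl.
  rewrite (integralD measurableT K1 K2) E1 E2.
  have iV i m : G.-integrable [set: T] (fun y => mixed_pow i m (translate A y)).
    exact: integrable_charge_translate.
  have mT y : measurable (translate A y) by exact: measurable_translate.
  have cE (a : Om -> R) y : \int[Q]_w (a w * c (w, y))%:E =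
      \int[Q]_w (a w * \1_(translate A y) (S w))%:E.
    by apply: eq_integral => w _; rewrite indic_translate.
  have -> : \int[G]_y ((cst 1 y)%:E * \int[Q]_w (e j w * c (w, y))%:E) =
      'C(n, j)%:R%:E * mixed_pow j (n.+1 - j) A.
    (* For [j > n] truncated subtraction breaks [n.+1 - j = (n - j).+1], but
       the binomial coefficient vanishes. *)
    have [jn|nj] := leqP j n; last first.
      rewrite bin_small// mul0e; apply: integral0_eq => y _.
      by rewrite mul1e cE eE// bin_small// mul0e.
    rewrite subSn// -mixed_pow_prob// /convolution integral_charge_finite_measure.
    rewrite -integralZl//; apply: eq_integral => y _.
    by rewrite mul1e cE eE.
  have -> : \int[G]_y ((f y)%:E * \int[Q]_w (p j w * c (w, y))%:E) =
      (be j)%:R%:E * mixed_pow j (n.+1 - j) A.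
    case: j {e'2 J1 J2 J3 J23 iee ipp iep K1 E1 K2 E2} => [|j] /=.
      rewrite mul0e; apply: integral0_eq => y _.
      by under eq_integral do rewrite mul0r; rewrite integral0 mule0.
    rewrite subSS -mixed_pow_charge// /convolution.
    set g := fun y => mixed_pow j (n - j) (translate A y).
    have gM y : `|g y| <= (fine (tv_norm (mixed_pow j (n - j))))%:E.
      by rewrite fineK ?tv_norm_fin_num//; exact: abse_le_tv_norm.
    have mg : measurable_fun [set: T] g by exact: measurable_charge_translate.
    rewrite (UE mg gM) -integralZl//.
      by apply: eq_integral => y _; rewrite cE eE// muleC -muleA.
    apply: le_integrable (integrableZl measurableT
      (fine (tv_norm (mixed_pow j (n - j)))) if1) => //.
      by apply: emeasurable_funM => //; exact/measurable_EFinP.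
    move=> y _; rewrite !abseM lee_wpmul2r//.
    by rewrite (le_trans (gM y))// lee_fin ler_norm.
  rewrite -muleDl ?mixed_pow_fin_num//.
  by rewrite -EFinD -natrD binE.
Qed.

(** Stated as a difference of two values because the total variation is
    attained on a Hahn decomposition; [|1_A - 1_B| <= 1] reduces the bound to
    the mean of [|e k|]. *)
Lemma mixed_pow_difference_le k m A B : measurable A -> measurable B ->
  mixed_pow k m A - mixed_pow k m B <=
  (Num.sqrt ('C(m + k, k)%:R^-1 * v ^+ k))%:E.
Proof.
move=> mA mB.
have [d' [Om [Q [S [e [mS me ie e2E eE]]]]]] := symmetric_representation (m + k).
have iee : Q.-integrable [set: Om] (EFin \o e k).
  exact: square_integrable_integrable.
have mI D : measurable D -> measurable_fun [set: Om] (fun w => \1_D (S w) : R).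
  by move=> mD; exact: measurableT_comp.
have iI D : measurable D ->
    Q.-integrable [set: Om] (fun w => (e k w * \1_D (S w))%:E).
  move=> mD; apply: le_integrable iee => //.
    by apply/measurable_EFinP/measurable_funM => //; exact: mI.
  move=> w _ /=; rewrite lee_fin normrM ler_piMr//.
  by rewrite indicE ger0_norm ?lern1 ?leq_b1.
have C0 : (0 < 'C(m + k, k)%:R :> R)%R by rewrite ltr0n bin_gt0 leq_addl.
have := integral_le_sqrt_integral_sqr (me k) (ie k) (e2E k).
have : \int[Q]_w ((e k w * \1_A (S w))%:E - (e k w * \1_B (S w))%:E) <=
    \int[Q]_w `|(e k w)%:E|.
  apply: le_integral => //.
  - by apply: integrableB => //; exact: iI.
  - exact: integrable_abse.
  move=> w _; rewrite -EFinB lee_fin -mulrBr (le_trans (ler_norm _))// normrM.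
  rewrite ler_piMr// !indicE.
  by case: (_ \in _); case: (_ \in _);
    rewrite ?subrr ?subr0 ?sub0r ?normrN ?normr0 ?normr1.
move=> /le_trans /[apply].
rewrite integralB//; [|exact: iI|exact: iI].
rewrite !eE// addnK.
rewrite -(fineK (mixed_pow_fin_num k m mA)) -(fineK (mixed_pow_fin_num k m mB)).
rewrite -!EFinM -!EFinB !lee_fin -mulrBr -ler_pdivlMl// => /le_trans; apply.
rewrite -[X in (X * _)%R](ger0_norm (ltW _)) ?invr_gt0//.
rewrite -sqrtr_sqr -sqrtrM ?sqr_ge0// ler_wsqrtr// le_eqVlt; apply/orP; left.
by apply/eqP; field; rewrite gt_eqF.
Qed.

End symmetric_functions.

(** * Total variation and mixtures *)

Section discrete_mixing.
Context d1 d2 d3 (T1 : measurableType d1) (T2 : measurableType d2)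
  (T3 : measurableType d3).

Lemma measurable_fun_discrete (h : nat -> T1 -> T3) (N : T2 -> nat) :
  (forall n, measurable_fun [set: T1] (h n)) -> measurable_fun [set: T2] N ->
  measurable_fun [set: T1 * T2] (fun z => h (N z.2) z.1).
Proof.
move=> mh mN _ B mB; rewrite setTI.
have -> : (fun z : T1 * T2 => h (N z.2) z.1) @^-1` B =
    \bigcup_n ((h n @^-1` B) `*` (N @^-1` [set n])).
  apply/seteqP; split => [z /= Bz|z [n _ [/= + Nn]]]; first by exists (N z.2).
  by rewrite Nn.
apply: bigcupT_measurable => n; apply: measurableX.
  by rewrite -[X in measurable X]setTI; exact: mh.
by rewrite -[X in measurable X]setTI; exact: mN.
Qed.

End discrete_mixing.

Section total_variation.
Context d (T : measurableType d) (R : realType).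

Lemma tv_norm_hahnE (V : {charge set T -> \bar R}) :
  tv_norm V = V (hahn_pos V) - V (hahn_neg V).
Proof.
rewrite /tv_norm variationE.
rewrite -[positive_part V setT]/(jordan_pos (hahnP V) setT).
rewrite -[negative_part V setT]/(jordan_neg (hahnP V) setT).
rewrite jordan_posE cjordan_posE jordan_negE cjordan_negE.
by rewrite /crestr0 !mem_set// /crestr !setTI.
Qed.

Lemma measurable_hahn (V : {charge set T -> \bar R}) :
  measurable (hahn_pos V) /\ measurable (hahn_neg V).
Proof. by have [[mP _] [mN _] _ _] := hahnP V. Qed.

End total_variation.

Section compound_convolution.
Context d (T : measurableZmodType d) (R : realType).
Context d' (Om : measurableType d') (P : probability Om R).
Variables (G : probability T R) (N : {RV P >-> nat}).

Lemma prob_pow_le1 n A : measurable A -> prob_pow G n A <= 1.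
Proof.
move=> mA; rewrite -(prob_powT G n) -(setUv A) chargeU//.
- by rewrite leeDl// prob_pow_ge0.
- exact: measurableC.
- exact: setICr.
Qed.

Lemma convolution_compound (V : {charge set T -> \bar R}) A : measurable A ->
  P.-integrable [set: Om] (fun w => convolution V (prob_pow G (N w)) A) /\
  convolution V (charge_of_finite_measure (compound G N)) A =
  \int[P]_w convolution V (prob_pow G (N w)) A.
Proof.
move=> mA.
have mh : measurable_fun [set: T * Om]
    (fun z => prob_pow G (N z.2) (translate A z.1)).
  apply: (measurable_fun_discrete (h := fun n x => prob_pow G n (translate A x))).
    by move=> n; exact: measurable_charge_translate.
  exact: measurable_funPT.
have h1 (z : T * Om) : `|prob_pow G (N z.2) (translate A z.1)| <= 1%:E.
  rewrite gee0_abs ?prob_pow_ge0//; apply: prob_pow_le1.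
  exact: measurable_translate.
have [ih hE] := integral_charge_fubini V P mh h1.
have cE w : convolution V (prob_pow G (N w)) A =
    integral_charge V (fun x => prob_pow G (N w) (translate A x)).
  by rewrite convolutionC.
split; first by apply: eq_integrable ih => // w _; rewrite cE.
rewrite convolutionC// -[LHS]/(integral_charge V _) hE.
by apply: eq_integral => w _; rewrite cE.
Qed.

End compound_convolution.

(** * Extended-real densities *)

Section density.
Context d (T : measurableType d) (R : realType).
Variables (mu : probability T R) (nu : {finite_measure set T -> \bar R}).
Variable h : T -> \bar R.
Hypothesis hP : is_density mu nu h.

Let mh : measurable_fun [set: T] h. Proof. by case: hP. Qed.

Let hE A : measurable A -> nu A = \int[mu]_(x in A) h x.
Proof. by case: hP => _; exact. Qed.

(** A density need not be nonnegative, but its integral is the finite number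
    [nu setT], and an extended-real integral is finite only if both its
    positive and its negative part have finite integrals. *)
Lemma density_integrable : mu.-integrable [set: T] h.
Proof.
apply/integrableP; split => //; apply/abse_integralP => //.
by rewrite -hE// gee0_abs// -ge0_fin_numE// fin_num_measure.
Qed.

Lemma density_ae_fine : ae_eq mu [set: T] h (EFin \o (fine \o h)).
Proof.
have := integrable_ae measurableT density_integrable.
by apply: filterS => x /(_ Logic.I) hx _ /=; rewrite fineK.
Qed.

Lemma density_fine_integrable : mu.-integrable [set: T] (EFin \o (fine \o h)).
Proof.
have mf : measurable_fun [set: T] (EFin \o (fine \o h)).
  by apply/measurable_EFinP; exact: measurableT_comp.
have [_ hi] := integrableP _ _ _ density_integrable.
apply/integrableP; split => //; rewrite (le_lt_trans _ hi)//.
apply: ge0_le_integral => //; do ?exact: measurableT_comp.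
by move=> x _ /=; case: (h x) => //=; rewrite normr0 leey.
Qed.

Lemma integral_density (g : T -> \bar R) (M : R) :
  measurable_fun [set: T] g -> (forall x, `|g x| <= M%:E) ->
  mu.-integrable [set: T] (fun x => g x * (fine (h x))%:E) /\
  \int[nu]_x g x = \int[mu]_x (g x * (fine (h x))%:E).
Proof.
move=> mg gM.
have mf : measurable_fun [set: T] (EFin \o (fine \o h)).
  exact: measurable_int density_fine_integrable.
have mgf : measurable_fun [set: T] (fun x => g x * (fine (h x))%:E).
  exact: emeasurable_funM.
split.
  apply: le_integrable (integrableZl measurableT M density_fine_integrable) => //.
  move=> x _; rewrite !abseM lee_wpmul2r//.
  by rewrite (le_trans (gM x))// lee_fin ler_norm.
have numu : nu `<< mu.
  apply/null_content_dominatesP => A mA muA0; rewrite hE//.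
  by apply: null_set_integral => //; exact: measurable_funTS.
have iRN : mu.-integrable [set: T]
    (Radon_Nikodym (charge_of_finite_measure nu) mu).
  exact: Radon_Nikodym_integrable.
rewrite -(Radon_Nikodym_change_of_variables numu measurableT); last first.
  exact: bounded_integrable gM.
apply: ae_eq_integral => //.
  by apply: emeasurable_funM => //; exact: measurable_int iRN.
apply: ae_eqe_mul2l; apply: ae_eq_trans density_ae_fine.
apply/ae_eq_sym/integral_ae_eq => //; first exact: density_integrable.
by move=> E _ mE; rewrite -hE// -Radon_Nikodym_integral.
Qed.

End density.

(** * The mean of the inverse binomial coefficient *)

Section moments.
Context (R : realType) d (Om : measurableType d) (P : probability Om R).
Variables (N : {RV P >-> nat}) (k : nat).

Definition inv_bin n : R := 'C(n + k, k)%:R^-1.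

Lemma inv_bin_gt0 n : (0 < inv_bin n)%R.
Proof. by rewrite invr_gt0 ltr0n bin_gt0 leq_addl. Qed.

Lemma inv_bin_le1 n : (inv_bin n <= 1)%R.
Proof. by rewrite invf_le1 ?ltr0n ?ler1n bin_gt0 leq_addl. Qed.

Lemma measurable_inv_bin (g : R -> R) :
  measurable_fun [set: Om] (fun w => g (inv_bin (N w))).
Proof. exact: (@measurableT_comp _ _ _ _ _ _ (fun n => g (inv_bin n))). Qed.

Lemma integrable_inv_bin : P.-integrable [set: Om] (fun w => (inv_bin (N w))%:E).
Proof.
apply: (@bounded_integrable _ _ _ _ _ 1).
  exact/measurable_EFinP/(measurable_inv_bin id).
by move=> w; rewrite lee_fin ger0_norm ?inv_bin_le1// ltW// inv_bin_gt0.
Qed.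

Definition mean_inv_bin : R := fine (\int[P]_w (inv_bin (N w))%:E).

Lemma mean_inv_binE : mean_inv_bin%:E = \int[P]_w (inv_bin (N w))%:E.
Proof. by rewrite fineK// integrable_fin_num// integrable_inv_bin. Qed.

Lemma mean_inv_bin_gt0 : (0 < mean_inv_bin)%R.
Proof.
have i0 : 0 <= \int[P]_w (inv_bin (N w))%:E.
  by apply: integral_ge0 => w _; rewrite lee_fin ltW// inv_bin_gt0.
rewrite lt_neqAle -lee_fin mean_inv_binE i0 andbT eq_sym; apply/eqP => m0.
have := mean_inv_binE; rewrite m0 => /esym iE.
have /ae_eq_integral_abs : \int[P]_w `|(inv_bin (N w))%:E| = 0.
  by rewrite -[RHS]iE; apply: eq_integral => w _;
    rewrite gee0_abs// lee_fin ltW// inv_bin_gt0.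
move=> /(_ measurableT (measurable_int _ integrable_inv_bin)).
case=> A [mA PA sA].
have : P [set: Om] <= 0.
  rewrite -PA le_measure ?inE// => w _; apply: sA => /(_ Logic.I) /= [/eqP].
  by rewrite gt_eqF// inv_bin_gt0.
by rewrite probability_setT lee_fin ler10.
Qed.

Lemma beta_inv_bin n : (0 < k)%N ->
  k%:R%:E * \int[lebesgue_measure]_(x in `[0%R, 1%R])
    (XMonemX k.-1 n x : R)%:E = (inv_bin n)%:E.
Proof.
move=> k_gt0; have /= := @EFin_beta_fun R k n.+1.
rewrite integral_XMonemX_restrict setTI => <-.
rewrite -EFinM; congr EFin; rewrite /inv_bin.
case: k k_gt0 => // j _; rewrite beta_fun_fact.
have C0 : ('C(n + j.+1, j.+1)%:R : R) != 0%R by rewrite pnatr_eq0 -lt0n bin_gt0 leq_addl.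
have F0 : ((j + n).+1`!%:R : R) != 0%R by rewrite pnatr_eq0 -lt0n fact_gt0.
apply: (mulfI C0); apply: (mulIf F0).
rewrite divff// mul1r mulrA mulrA divfK// -!natrM; congr (_%:R).
have := @bin_fact (n + j.+1) j.+1 (leq_addl _ _).
by rewrite addnK factS -addSn addnC => <-; rewrite !mulnA.
Qed.

Lemma integral_generating_function : (0 < k)%N ->
  k%:R%:E * \int[lebesgue_measure]_(x in `[0%R, 1%R])
    ((x ^+ k.-1)%:E * generating_function N (1 - x)%R) = mean_inv_bin%:E.
Proof.
move=> k_gt0; rewrite mean_inv_binE.
set D : set R := `[0%R, 1%R]%classic.
pose h (z : R * Om) : \bar R := ((XMonemX k.-1 (N z.2) \_D) z.1)%:E.
have h0 z : 0 <= h z.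
  rewrite lee_fin patchE; case: ifPn => // /[!inE] zD.
  exact: (XMonemX_ge0 _ _ zD).
have mh : measurable_fun [set: R * Om] h.
  apply/measurable_EFinP.
  apply: (measurable_fun_discrete (h := fun n x => (XMonemX k.-1 n \_D) x)) => // n.
  apply/(measurable_restrictT _ _).1; first exact: measurable_itv.
  exact: measurable_XMonemX.
have -> : \int[lebesgue_measure]_(x in D)
    ((x ^+ k.-1)%:E * generating_function N (1 - x)%R) =
    \int[lebesgue_measure]_x \int[P]_w h (x, w).
  rewrite [LHS]integral_mkcond; apply: eq_integral => x _.
  rewrite patchE; case: ifPn => xD; last first.
    rewrite integral0_eq// => w _.
    by rewrite /h patchE (negbTE xD).
  rewrite /generating_function unlock -ge0_integralZl//.
  - by apply: eq_integral => w _; rewrite /h patchE xD -EFinM.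
  - apply/measurable_EFinP.
    exact: (@measurableT_comp _ _ _ _ _ _ (fun n => ((1 - x) ^+ n)%R)).
  - move: xD; rewrite inE /D/= in_itv/= => /andP[x0 x1] w _.
    by rewrite lee_fin exprn_ge0// subr_ge0.
  - move: xD; rewrite inE /D/= in_itv/= => /andP[x0 x1].
    by rewrite lee_fin exprn_ge0.
rewrite fubini_tonelli// -ge0_integralZl//.
- apply: eq_integral => w _; rewrite -beta_inv_bin//; congr (_ * _).
  by rewrite [RHS]integral_mkcond; apply: eq_integral => x _; rewrite /h !patchE;
    case: ifPn.
- exact: measurable_fun_fubini_tonelli_G.
- by move=> w _; exact: integral_ge0.
Qed.

Lemma poisson_inv_bin (t : R) n : (0 < t)%R ->
  (poisson_pmf t n * inv_bin n = k`!%:R / t ^+ k * poisson_pmf t (n + k))%R.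
Proof.
move=> t0; rewrite /poisson_pmf t0 /inv_bin.
have C0 : ('C(n + k, k)%:R : R) != 0%R by rewrite pnatr_eq0 -lt0n bin_gt0 leq_addl.
have F0 i : (i`!%:R : R) != 0%R by rewrite pnatr_eq0 -lt0n fact_gt0.
have tk0 : (t ^+ k != 0)%R by rewrite expf_neq0// gt_eqF.
rewrite -(@bin_fact (n + k) k (leq_addl _ _)) addnK !natrM exprD.
by field; rewrite tk0 C0 !F0.
Qed.

Lemma mean_inv_bin_poisson (t : R) : (0 < t)%R ->
  (forall m : nat, P [set w | N w = m] = (poisson_pmf t m)%:E) ->
  (mean_inv_bin =
    k`!%:R / t ^+ k * fine (P [set w | (k <= N w)%N]))%R.
Proof.
move=> t0 NP; apply: EFin_inj; rewrite EFinM mean_inv_binE.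
have mN n : measurable [set w | N w = n].
  by rewrite (_ : [set w | N w = n] = N @^-1` [set n])//; exact: measurable_funPTI.
have cE : [set w | (k <= N w)%N] = \bigcup_n [set w | N w = (n + k)%N].
  apply/seteqP; split => [w /= kN|w [n _ /= ->]]; last exact: leq_addl.
  by exists (N w - k)%N => //=; rewrite subnK.
have PE : P [set w | (k <= N w)%N] = \sum_(n <oo) (poisson_pmf t (n + k))%:E.
  rewrite cE measure_bigcup//; last first.
    by apply/trivIsetP => i j _ _ ij; apply/seteqP; split => // w [/= ->] /addIn /eqP;
      rewrite (negbTE ij).
  rewrite (eq_eseriesl (Q := xpredT)); last by move=> n; rewrite in_setT.
  by apply: eq_eseriesr => n _; exact: NP.
rewrite fineK; last by rewrite fin_num_measure// cE; exact: bigcupT_measurable.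
rewrite PE -nneseriesZl; last first.
  by move=> n _; rewrite lee_fin poisson_pmf_ge0.
rewrite -(@ge0_integral_distribution _ _ _ _ _ _ N
  (fun n => (inv_bin n)%:E))//; last first.
  by move=> n; rewrite lee_fin ltW// inv_bin_gt0.
have -> : [set: nat] = \bigcup_n [set n].
  by apply/seteqP; split => // n _; exists n.
rewrite ge0_integral_bigcup//; last 2 first.
- by move=> n _; rewrite lee_fin ltW// inv_bin_gt0.
- by apply/trivIsetP => i j _ _ /eqP ij; apply/seteqP; split => // n [/= -> /ij].
apply: eq_eseriesr => n _.
rewrite (eq_integral (cst (inv_bin n)%:E)); last by move=> m /[!inE] ->.
rewrite integral_cst// -[X in _ * X]/(P [set w | N w = n]) NP -!EFinM.
by rewrite mulrC poisson_inv_bin.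
Qed.

End moments.

(** * The total variation bound *)

Section smoothing.
Context d (X : measurableZmodType d) (R : realType).
Variables (G : probability X R) (U : {charge set X -> \bar R}).
Context d' (Omega : measurableType d') (P : probability Omega R).
Variables (N : {RV P >-> nat}) (k : nat).

(** The mixture is bounded under the integral over [N], evaluating every
    component on the Hahn decomposition of the mixture itself; Cauchy-Schwarz
    in [N] then moves the mean inside the square root. *)
Lemma tv_norm_compound_le (f : X -> R) (v : R) :
  measurable_fun [set: X] f ->
  G.-integrable [set: X] (fun x => (f x ^+ 2)%:E) ->
  \int[G]_x (f x ^+ 2)%:E = v%:E ->
  \int[G]_x (f x)%:E = 0 ->
  (forall (g : X -> \bar R) (M : R),
    measurable_fun [set: X] g -> (forall x, `|g x| <= M%:E) ->
    integral_charge U g = \int[G]_x (g x * (f x)%:E)) ->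
  tv_norm (convolution (convolution_pow U k)
    (charge_of_finite_measure (compound G N))) <=
  (Num.sqrt (mean_inv_bin N k * v ^+ k))%:E.
Proof.
move=> mf if2 f2E f0 UE.
set V := convolution _ _.
have v0 : (0 <= v)%R.
  by rewrite -lee_fin -f2E; apply: integral_ge0 => x _; rewrite lee_fin sqr_ge0.
have [mp mn] := measurable_hahn V.
have [ip pE] := convolution_compound G N (convolution_pow U k) mp.
have [iN nE] := convolution_compound G N (convolution_pow U k) mn.
rewrite tv_norm_hahnE [X in X - _]pE [X in _ - X]nE -integralB//.
pose a w : R := Num.sqrt (inv_bin R k (N w) * v ^+ k).
have ma : measurable_fun [set: Omega] a.
  exact: (measurable_inv_bin N k (fun c => Num.sqrt (c * v ^+ k))).
have a2 w : (a w ^+ 2 = v ^+ k * inv_bin R k (N w))%R.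
  by rewrite sqr_sqrtr 1?mulrC// mulr_ge0 ?exprn_ge0// ltW// inv_bin_gt0.
have ia2 : P.-integrable [set: Omega] (fun w => (a w ^+ 2)%:E).
  apply: eq_integrable (integrableZl measurableT (v ^+ k) (integrable_inv_bin N k)) => //.
  by move=> w _; rewrite a2 EFinM.
have a2E : \int[P]_w (a w ^+ 2)%:E = (mean_inv_bin N k * v ^+ k)%:E.
  rewrite mulrC EFinM mean_inv_binE -integralZl//; last exact: integrable_inv_bin.
  by apply: eq_integral => w _; rewrite a2 EFinM.
apply: le_trans (integral_le_sqrt_integral_sqr ma ia2 a2E).
apply: le_integral => //.
- exact: integrableB.
- by apply: integrable_abse; exact: square_integrable_integrable.
- move=> w _; apply: le_trans (mixed_pow_difference_le mf if2 f2E f0 UE k (N w) mp mn) _.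
  by rewrite lee_fin ler_norm.
Qed.

(** Passage from extended-real densities to the real function
    [fine fp - fine fn], which has the same second moment since [fp] and [fn]
    are finite almost everywhere. *)
Lemma tv_norm_compound_density_le (fp fn : X -> \bar R) :
  (0 < k)%N -> U [set: X] = 0 ->
  is_density G (positive_part U) fp ->
  is_density G (negative_part U) fn ->
  tv_norm (convolution (convolution_pow U k)
    (charge_of_finite_measure (compound G N))) <=
  (Num.sqrt (mean_inv_bin N k))%:E *
  (\int[G]_x (fp x - fn x) ^+ 2) `^ (k%:R / 2).
Proof.
move=> k_gt0 UT dp dn.
have kR0 : (k%:R / 2 : R)%R != 0%R.
  by rewrite mulf_neq0// ?invr_eq0 ?pnatr_eq0// -lt0n.
pose f x : R := (fine (fp x) - fine (fn x))%R.
have mfin (h : X -> \bar R) : measurable_fun [set: X] h ->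
    measurable_fun [set: X] (fun x => fine (h x)).
  by move=> mh; exact: measurableT_comp.
have mfp : measurable_fun [set: X] fp by case: dp.
have mfn : measurable_fun [set: X] fn by case: dn.
have mf : measurable_fun [set: X] f by apply: measurable_funB; exact: mfin.
have fE : ae_eq G [set: X] (fun x => (fp x - fn x) ^+ 2)
    (fun x => (f x ^+ 2)%:E).
  have := density_ae_fine dn; have := density_ae_fine dp.
  by apply: filterS2 => x /(_ Logic.I) px /(_ Logic.I) nx _; rewrite px nx.
have f2E : \int[G]_x (fp x - fn x) ^+ 2 = \int[G]_x (f x ^+ 2)%:E.
  apply: ge0_ae_eq_integral => //.
  - under eq_fun do rewrite expe2.
    by apply: emeasurable_funM; exact: emeasurable_funB.
  - exact/measurable_EFinP/measurable_funX.
  - by move=> x _; exact: sqre_ge0.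
  - by move=> x _; rewrite lee_fin sqr_ge0.
have UE (g : X -> \bar R) (M : R) :
    measurable_fun [set: X] g -> (forall x, `|g x| <= M%:E) ->
    integral_charge U g = \int[G]_x (g x * (f x)%:E).
  move=> mg gM.
  have [ip pE] := integral_density dp mg gM.
  have [iN nE] := integral_density dn mg gM.
  rewrite /integral_charge pE nE -integralB//; apply: eq_integral => x _.
  by rewrite /= EFinB muleBr// fin_num_abs (le_lt_trans (gM x))// ltry.
have f0 : \int[G]_x (f x)%:E = 0.
  have c1 (x : X) : `|cst 1 x| <= 1%R%:E :> \bar R by rewrite /= normr1.
  have := UE (cst 1) 1%R (measurable_cst _) c1.
  rewrite /integral_charge !integral_cst// !mul1e.
  rewrite -positive_negative_partE// UT => /esym intf0; rewrite -[RHS]intf0.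
  by apply: eq_integral => x _; rewrite mul1e.
rewrite f2E.
have i0 : 0 <= \int[G]_x (f x ^+ 2)%:E.
  by apply: integral_ge0 => x _; rewrite lee_fin sqr_ge0.
have [ioo|ioo] := eqVneq (\int[G]_x (f x ^+ 2)%:E) +oo.
  rewrite ioo poweRyr// gt0_muley ?leey//.
  by rewrite lte_fin sqrtr_gt0 mean_inv_bin_gt0.
have ifin : \int[G]_x (f x ^+ 2)%:E \is a fin_num.
  by rewrite ge0_fin_numE// ltey.
have if2 : G.-integrable [set: X] (fun x => (f x ^+ 2)%:E).
  apply/integrableP; split; first exact/measurable_EFinP/measurable_funX.
  by rewrite (integral_fin_num_abs _ measurableT)//; exact: measurable_funX.
rewrite -(fineK ifin); set v := fine _.
have v0 : (0 <= v)%R by exact: fine_ge0.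
rewrite poweR_EFin -EFinM.
have -> : (v `^ (k%:R / 2) = Num.sqrt (v ^+ k))%R.
  by rewrite powRrM powR_mulrn// powR12_sqrt// exprn_ge0.
rewrite -sqrtrM; last exact/ltW/mean_inv_bin_gt0.
have vE : \int[G]_x (f x ^+ 2)%:E = v%:E by rewrite fineK.
exact: (tv_norm_compound_le mf if2 vE f0 UE).
Qed.

End smoothing.

Theorem corollary4p2 (d : measure_display) (X : measurableZmodType d)
    (R : realType) (k : nat) (G : probability X R)
    (U : {charge set X -> \bar R}) (fp fn : X -> \bar R)
    (d' : measure_display) (Omega : measurableType d')
    (P : probability Omega R) (N : {RV P >-> nat})
    (k_gt0 : (0 < k)%N)
    (U_dominated : variation_measure U `<< G)
    (U_total : U [set: X] = 0)
    (fp_density : is_density G (positive_part U) fp)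
    (fn_density : is_density G (negative_part U) fn) :
  let f := fun x => fp x - fn x in
  let UkphiG :=
    convolution (convolution_pow U k)
      (charge_of_finite_measure (compound G N)) in
  tv_norm UkphiG <=
    (k%:R%:E * \int[lebesgue_measure]_(x in `[0%R, 1%R])
                 ((x ^+ k.-1)%:E * generating_function N (1 - x)%R)) `^ 2^-1
    * (\int[G]_x f x ^+ 2) `^ (k%:R / 2)
  /\
  forall t : R, (0 < t)%R ->
    (forall m : nat, P [set w | N w = m] = (poisson_pmf t m)%:E) ->
    tv_norm UkphiG <=
      ((t `^ (k%:R / 2))^-1 *
       Num.sqrt (k`!%:R * fine (P [set w | (k <= N w)%N])))%:E
      * (\int[G]_x f x ^+ 2) `^ (k%:R / 2).
Proof.
move=> f UkphiG.
have bound := tv_norm_compound_density_le N k_gt0 U_total fp_density fn_density.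
have m0 := mean_inv_bin_gt0 N k.
split => [|t t0 NP].
  apply: le_trans bound _; rewrite integral_generating_function// poweR_EFin.
  by rewrite powR12_sqrt// ltW.
apply: le_trans bound _; rewrite (mean_inv_bin_poisson k t0 NP).
have tk : (Num.sqrt (t ^+ k) = t `^ (k%:R / 2))%R.
  by rewrite powRrM powR_mulrn ?powR12_sqrt ?exprn_ge0// ltW.
have tk0 : (0 <= (t ^+ k)^-1)%R by rewrite invr_ge0 exprn_ge0// ltW.
by rewrite mulrAC mulrC sqrtrM// sqrtrV ?exprn_ge0 ?tk// ltW.
Qed.
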